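(* Let $\lambda\neq1$ and let $\alpha$ be defined by $\lambda=\frac{\alpha+1}{2}$. Let $p_0,\dots,p_d$ be probability densities with respect to $\nu$ for which the $\lambda$-mixture family $\{p(\cdot;\eta)\}$ is well defined. Then this $\lambda$-mixture family is a reparameterization of the $\alpha$-mixture family $\{p_\alpha(\cdot;w)\}$ with the same base densities $p_0,\dots,p_d$; that is, there is a bijection $\eta\mapsto w$ of the simplex $\{w\in\mathbb{R}^{1+d}:w_i\ge0,\ \sum_{i=0}^dw_i=1\}$ onto itself such that $p(\cdot;\eta)=p_\alpha(\cdot;w)$.
   Context: The escort transformation with exponent $a\neq0$ is $\mathcal{E}_a[p]=p^a/\int p^a\,d\nu$ (when $\int p^a\,d\nu$ is finite). $\lambda$-mixture family ($\lambda\neq1$, $q=1-\lambda$) with respect to densities $p_0,\dots,p_d$: with $\widetilde p_i=\mathcal{E}_q[p_i]$, $$p(\cdot;\eta)=\mathcal{E}_{1/q}\Big[\sum_{i=0}^d\eta_i\widetilde p_i\Big]=\frac{\left(\sum_{i=0}^d\eta_i\widetilde p_i\right)^{1/q}}{\int\left(\sum_{j=0}^d\eta_j\widetilde p_j\right)^{1/q}d\nu},\qquad\eta_i\ge0,\ \sum_{i=0}^d\eta_i=1;$$ it is well defined when all the integrals involved converge. $\alpha$-mixture family ($\alpha\neq1$): $p_\alpha(x;w)=c(w)\big(\sum_{i=0}^dw_ip_i(x)^{(1-\alpha)/2}\big)^{2/(1-\alpha)}$, with $w_i\ge0$, $\sum_iw_i=1$, and $c(w)$ the normalizing constant making it a probability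 density. *)

(* Defs.v *)
From HB Require Import structures.
From mathcomp Require Import all_boot all_order all_algebra.
From mathcomp Require Import all_classical all_reals all_analysis.

Set Implicit Arguments.
Unset Strict Implicit.
Unset Printing Implicit Defensive.

Import Order.TTheory GRing.Theory Num.Theory.
Import numFieldNormedType.Exports.

Local Open Scope classical_set_scope.
Local Open Scope ring_scope.
Local Open Scope ereal_scope.

(* Nonnegative extended reals raised to a real exponent.  For a < 0 this takes
   0 ^ a = +oo and (+oo) ^ a = 0, whereas [poweR] has 0 `^ a = 0 and
   (+oo) `^ a = +oo there.  The densities below may vanish, so for negative
   exponents the convergence of the integrals depends on this convention. *)
Definition epow (R : realType) (x : \bar R) (a : R) : \bar R :=
  if (0 <= a)%R then x `^ a else (x `^ (- a)%R)^-1.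

Definition is_density (d : measure_display) (T : measurableType d)
    (R : realType) (nu : {measure set T -> \bar R}) (p : T -> R) : Prop :=
  [/\ measurable_fun setT p,
      (forall x, (0 <= p x)%R) &
      \int[nu]_x (p x)%:E = 1].

Definition escort (d : measure_display) (T : measurableType d)
    (R : realType) (nu : {measure set T -> \bar R}) (a : R)
    (p : T -> \bar R) (x : T) : \bar R :=
  epow (p x) a / \int[nu]_y epow (p y) a.

Definition simplex (R : realType) (n : nat) : set 'rV[R]_n.+1 :=
  [set w | (forall i, (0 <= w ord0 i)%R) /\ (\sum_i w ord0 i = 1)%R].

Definition escort_mean (d : measure_display) (T : measurableType d)
    (R : realType) (nu : {measure set T -> \bar R}) (n : nat)
    (p : 'I_n.+1 -> T -> R) (q : R) (eta : 'rV[R]_n.+1) (x : T) : \bar R :=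
  \sum_(i < n.+1) (eta ord0 i)%:E * escort nu q (EFin \o p i) x.

Definition lambda_mixture (d : measure_display) (T : measurableType d)
    (R : realType) (nu : {measure set T -> \bar R}) (n : nat)
    (p : 'I_n.+1 -> T -> R) (lambda : R) (eta : 'rV[R]_n.+1) : T -> \bar R :=
  let q := (1 - lambda)%R in
  escort nu q^-1%R (escort_mean nu p q eta).

(* The integrands are nonnegative, so convergence means that the integral is
   not +oo.  None of these integrals can vanish when the p i are densities. *)
Definition lambda_mixture_well_defined (d : measure_display)
    (T : measurableType d) (R : realType) (nu : {measure set T -> \bar R})
    (n : nat) (p : 'I_n.+1 -> T -> R) (lambda : R) : Prop :=
  let q := (1 - lambda)%R in
  (forall i, \int[nu]_x epow (p i x)%:E q < +oo) /\
  (forall eta, simplex eta ->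
     \int[nu]_x epow (escort_mean nu p q eta x) q^-1%R < +oo).

Definition alpha_power_sum (T : Type) (R : realType) (n : nat)
    (p : 'I_n.+1 -> T -> R) (alpha : R) (w : 'rV[R]_n.+1) (x : T) : \bar R :=
  epow (\sum_(i < n.+1)
          (w ord0 i)%:E * epow (p i x)%:E ((1 - alpha) / 2)%R)
       (2 / (1 - alpha))%R.

Definition alpha_normalizer (d : measure_display) (T : measurableType d)
    (R : realType) (nu : {measure set T -> \bar R}) (n : nat)
    (p : 'I_n.+1 -> T -> R) (alpha : R) (w : 'rV[R]_n.+1) : \bar R :=
  (\int[nu]_x alpha_power_sum p alpha w x)^-1.

Definition alpha_mixture (d : measure_display) (T : measurableType d)
    (R : realType) (nu : {measure set T -> \bar R}) (n : nat)
    (p : 'I_n.+1 -> T -> R) (alpha : R) (w : 'rV[R]_n.+1) (x : T) : \bar R :=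
  alpha_normalizer nu p alpha w * alpha_power_sum p alpha w x.

(* Main.v *)
(** Since 1 - lambda = (1 - alpha) / 2 =: q, both families take the power 1/q of
    a mixture of the functions p_i^q; they differ only in that the escort
    densities are normalized by Z_i, the integral of p_i^q.  Hence w_i must be
    proportional to eta_i / Z_i, a projective map of the simplex whose inverse
    sends w to the weights proportional to w_i Z_i; the remaining common factor
    cancels because the escort transformation is invariant under scaling. *)
Require Import Defs.
From HB Require Import structures.
From mathcomp Require Import all_boot all_order all_algebra.
From mathcomp Require Import all_classical all_reals all_analysis.
From mathcomp Require Import measurable_realfun ring.

Set Implicit Arguments.
Unset Strict Implicit.
Unset Printing Implicit Defensive.

Import Order.TTheory GRing.Theory Num.Theory.
Import numFieldNormedType.Exports.

Local Open Scope classical_set_scope.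
Local Open Scope ring_scope.

Definition reweight (R : realType) (n : nat) (c : 'I_n.+1 -> R)
    (w : 'rV[R]_n.+1) : 'rV[R]_n.+1 :=
  \row_i (c i * w ord0 i / \sum_j c j * w ord0 j).

(** If this sum of nonnegative terms vanished, every weight would be zero, contradicting total mass
    1. *)
Lemma simplex_sum_gt0 (R : realType) (n : nat) (c : 'I_n.+1 -> R)
    (w : 'rV[R]_n.+1) :
  (forall i, 0 < c i) -> simplex w -> 0 < \sum_j c j * w ord0 j.
Proof.
move=> c0 [w0 w1].
have cw0 j : true -> 0 <= c j * w ord0 j.
  by move=> _; rewrite mulr_ge0// ltW.
rewrite lt_neqAle sumr_ge0// andbT eq_sym psumr_eq0//.
apply/negP => /allP cw; move: w1; rewrite big1 => [/eqP|i _].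
  by rewrite eq_sym oner_eq0.
by apply/eqP; have := cw i (mem_index_enum _); rewrite mulf_eq0 gt_eqF.
Qed.

Lemma simplex_reweight (R : realType) (n : nat) (c : 'I_n.+1 -> R)
    (w : 'rV[R]_n.+1) :
  (forall i, 0 < c i) -> simplex w -> simplex (reweight c w).
Proof.
move=> c0 sw; have S0 := simplex_sum_gt0 c0 sw; split=> [i|].
  by rewrite mxE divr_ge0 ?(ltW S0)// mulr_ge0 ?(ltW (c0 i))//; case: sw.
under eq_bigr do rewrite mxE.
by rewrite -mulr_suml divff// gt_eqF.
Qed.

(** The inner normalizing sum is a common factor, which the outer normalization cancels. Stating
    inverse coefficients as [b i * c i = 1] lets the lemma serve for both orders of composition. *)
Lemma reweightK (R : realType) (n : nat) (c b : 'I_n.+1 -> R)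
    (w : 'rV[R]_n.+1) :
  (forall i, 0 < c i) -> (forall i, b i * c i = 1) -> simplex w ->
  reweight b (reweight c w) = w.
Proof.
move=> c0 bc sw; have S0 := simplex_sum_gt0 c0 sw; have [_ w1] := sw.
have bE j : b j * reweight c w ord0 j = w ord0 j / \sum_j c j * w ord0 j.
  by rewrite mxE !mulrA bc mul1r.
apply/rowP => i; rewrite mxE bE (eq_bigr _ (fun j _ => bE j)).
by rewrite -mulr_suml w1 div1r invrK divfK// gt_eqF.
Qed.

Lemma reweight_bij (R : realType) (n : nat) (c : 'I_n.+1 -> R) :
  (forall i, 0 < c i) -> set_bij (@simplex R n) (@simplex R n) (reweight c).
Proof.
move=> c0; have V0 i : 0 < (c i)^-1 by rewrite invr_gt0.
have Vc i : (c i)^-1 * c i = 1 by rewrite mulVf ?gt_eqF.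
have cV i : c i * (c i)^-1 = 1 by rewrite mulfV ?gt_eqF.
split=> [w sw|w w'|w sw].
- exact: simplex_reweight.
- move=> /set_mem sw /set_mem sw' e.
  by rewrite -(reweightK c0 Vc sw) e reweightK.
- by exists (reweight (fun i => (c i)^-1) w);
    [exact: simplex_reweight|exact: reweightK].
Qed.

Local Open Scope ereal_scope.

Lemma epow_ge0 (R : realType) (x : \bar R) (a : R) : 0 <= epow x a.
Proof. by rewrite /epow; case: ifP => _; rewrite ?inve_ge0 poweR_ge0. Qed.

Lemma epow_gt0_fin (R : realType) (k a : R) :
  (0 < k)%R -> exists2 r : R, (0 < r)%R & epow k%:E a = r%:E.
Proof.
move=> k0; rewrite /epow; case: ifP => _; rewrite poweR_EFin.
  by exists (k `^ a)%R => //; exact: powR_gt0.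
have r0 : (0 < k `^ (- a))%R by exact: powR_gt0.
by exists ((k `^ (- a))^-1)%R; rewrite ?invr_gt0// inver gt_eqF.
Qed.

(** A positive finite factor excludes the products of 0 and +oo, for which multiplicativity of the
    inverse breaks down. *)
Lemma inveM_gt0 (R : realType) (r : R) (x : \bar R) :
  (0 < r)%R -> 0 <= x -> (r%:E * x)^-1 = r%:E^-1 * x^-1.
Proof.
move=> r0; case: x => [s| |]// _; apply: inveM => //=.
by rewrite gt_eqF//= (ltW r0) implybT.
Qed.

Lemma epowZ (R : realType) (k : R) (x : \bar R) (a : R) :
  (0 < k)%R -> 0 <= x -> epow (k%:E * x) a = epow k%:E a * epow x a.
Proof.
move=> k0 x0; have k0' : 0 <= k%:E by rewrite lee_fin ltW.
rewrite /epow; case: ifP => _; rewrite poweRM//.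
by rewrite poweR_EFin inveM_gt0 ?poweR_ge0 ?powR_gt0.
Qed.

(** For negative [a] the premise is impossible: an inverse vanishes only at +oo, and a power of a
    real is finite. *)
Lemma epow_eq0 (R : realType) (x a : R) : epow x%:E a = 0 -> x = 0%R.
Proof.
rewrite /epow; case: ifP => _ /eqP; rewrite poweR_EFin.
  by rewrite eqe powR_eq0 => /andP[/eqP].
by rewrite inve_eq0.
Qed.

Lemma measurable_epow (R : realType) (a : R) :
  measurable_fun [set: \bar R] (fun x => epow x a).
Proof.
rewrite /epow; case: (0 <= a)%R; first exact: measurable_poweR.
(* [inve] and [poweR] with exponent -1 disagree at 0 and at +oo. *)
have iE (y : \bar R) : 0 <= y ->
    y^-1 = if y == 0 then +oo else if y == +oo then 0 else y `^ (- 1).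
  case: y => [r| |]// r0; rewrite inver eqe; case: ifP => // r0'.
  by rewrite poweR_EFin powR_inv1.
under eq_fun do rewrite iE ?poweR_ge0//.
apply: measurable_fun_ifT => //.
  by apply: measurable_fun_eqe => //; exact: measurable_poweR.
apply: measurable_fun_ifT => //.
  by apply: measurable_fun_eqe => //; exact: measurable_poweR.
by apply: (measurableT_comp (measurable_poweR _)); exact: measurable_poweR.
Qed.

(** The factor [epow k%:E a] leaves both the power and the integral. Being positive and finite, it
    cancels whatever value in [0, +oo] the integral takes. *)
Lemma escortZ (d : measure_display) (T : measurableType d) (R : realType)
    (nu : {measure set T -> \bar R}) (a k : R) (g : T -> \bar R) (x : T) :
  (0 < k)%R -> measurable_fun setT g -> (forall y, 0 <= g y) ->
  escort nu a (fun y => k%:E * g y) x = escort nu a g x.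
Proof.
move=> k0 mg g0; rewrite /escort.
under eq_integral do rewrite epowZ//.
rewrite epowZ//; have [r r0 ->] := epow_gt0_fin a k0.
rewrite ge0_integralZl//; last 3 first.
- by apply: (measurableT_comp (measurable_epow _)).
- by move=> *; exact: epow_ge0.
- by rewrite lee_fin ltW.
rewrite inveM_gt0//; last by apply: integral_ge0 => *; exact: epow_ge0.
by rewrite muleACA inver gt_eqF// -EFinM divff ?gt_eqF// mul1e.
Qed.

(** A zero integral would make the power, hence [p] itself, vanish almost everywhere, against total
    mass 1. *)
Lemma density_integral_epow_gt0 (d : measure_display) (T : measurableType d)
    (R : realType) (nu : {measure set T -> \bar R}) (p : T -> R) (a : R) :
  is_density nu p -> 0 < \int[nu]_x epow (p x)%:E a.
Proof.
move=> [mp p0 p1]; have mpE : measurable_fun setT (EFin \o p).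
  exact/measurable_EFinP.
rewrite lt0e integral_ge0 ?andbT; last by move=> *; exact: epow_ge0.
apply/eqP => e0.
have mpa : measurable_fun setT (fun x => epow (p x)%:E a).
  exact: (measurableT_comp (measurable_epow _)).
have pa0 : {ae nu, forall x, setT x -> epow (p x)%:E a = 0}.
  apply/(ae_eq_integral_abs nu measurableT mpa).
  by rewrite -[RHS]e0; apply: eq_integral => x _; rewrite gee0_abs ?epow_ge0.
have : \int[nu]_x (p x)%:E = \int[nu]_x (cst 0 x : \bar R).
  apply: ae_eq_integral => //.
  by apply: filterS pa0 => x /= + _ => /(_ I) /epow_eq0 ->.
by rewrite p1 integral0 => /eqP; rewrite onee_eq0.
Qed.

Local Close Scope ereal_scope.

Theorem proposition4p12 (disp : measure_display) (T : measurableType disp)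
    (R : realType) (nu : {measure set T -> \bar R})
    (lambda alpha : R) (lambda_neq1 : lambda != 1)
    (lambdaE : lambda = (alpha + 1) / 2)
    (d : nat) (p : 'I_d.+1 -> T -> R)
    (p_density : forall i, is_density nu (p i))
    (p_wd : lambda_mixture_well_defined nu p lambda) :
  exists f : 'rV[R]_d.+1 -> 'rV[R]_d.+1,
    set_bij (@simplex R d) (@simplex R d) f /\
    forall eta : 'rV[R]_d.+1, simplex eta ->
      forall x : T,
        lambda_mixture nu p lambda eta x = alpha_mixture nu p alpha (f eta) x.
Proof.
set q := (1 - lambda)%R.
have qE : q = ((1 - alpha) / 2)%R by rewrite /q lambdaE; field.
have qVE : q^-1%R = (2 / (1 - alpha))%R by rewrite qE invf_div.
have [Z_lty _] := p_wd.
(* [fine] loses nothing here: well-definedness makes these integrals finite. *)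
pose z i := fine (\int[nu]_x epow (p i x)%:E q).
have Zgt0 i : (0 < \int[nu]_x epow (p i x)%:E q)%E.
  exact: density_integral_epow_gt0.
have zE i : (\int[nu]_x epow (p i x)%:E q)%E = (z i)%:E.
  by rewrite fineK// ge0_fin_numE ?ltW//; exact: Z_lty.
have z0 i : (0 < z i)%R by rewrite -lte_fin -zE.
have c0 i : (0 < (z i)^-1)%R by rewrite invr_gt0.
exists (reweight (fun i => (z i)^-1)%R); split; first exact: reweight_bij.
move=> eta seta x.
set w := reweight _ eta; set S := (\sum_j (z j)^-1 * eta ord0 j)%R.
have S0 : (0 < S)%R by exact: simplex_sum_gt0.
have [w0 _] : simplex w by exact: simplex_reweight.
pose g y : \bar R := (\sum_(i < d.+1) (w ord0 i)%:E * epow (p i y)%:E q)%E.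
(* For negative [q] a term can be +oo where [p i] vanishes; nonnegativity is what allows [S] to be
   distributed over the sum. *)
have wg0 y i : (0 <= (w ord0 i)%:E * epow (p i y)%:E q)%E.
  by rewrite mule_ge0 ?lee_fin ?w0 ?epow_ge0.
have g0 y : (0 <= g y)%E by apply: sume_ge0 => i _.
have mg : measurable_fun setT g.
  apply: emeasurable_sum => i; apply: measurable_funeM.
  apply: (measurableT_comp (measurable_epow _)).
  by apply/measurable_EFinP; case: (p_density i).
(* By the choice of [w], [eta_i / z_i = S * w_i], and [S] depends on neither [i] nor [y]. *)
have meanE : escort_mean nu p q eta = (fun y => S%:E * g y)%E.
  apply/funext => y; rewrite /escort_mean /g ge0_sume_distrr//.
  apply: eq_bigr => i _; rewrite /escort /= zE inver gt_eqF// muleA muleAC.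
  rewrite muleA -!EFinM mxE -/S; congr (_%:E * _)%E.
  by field; rewrite !gt_eqF.
rewrite /lambda_mixture -/q meanE escortZ// /escort /alpha_mixture.
by rewrite /alpha_normalizer /alpha_power_sum -qE -qVE muleC.
Qed.
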